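(* Let $N\ge2$, $p_A\in(0,1)$, $\sigma_0,\sigma_1>0$. (1) If $\sigma_0>\sigma_1$ and $$\log\!\left(\frac{\sigma_1^2}{\sigma_0^2}\right)+1-\frac{\sigma_1^2}{\sigma_0^2}<\frac{2\log(1-p_A)}{N},$$ then $\xi_>(a,\sigma_1)>\tfrac12$ for every $a\ge0$. (2) If $\sigma_0<\sigma_1$ and $$\log\!\left(\frac{\sigma_1^2}{\sigma_0^2}\frac{N-1}{N}\right)+1-\frac{\sigma_1^2}{\sigma_0^2}\frac{N-1}{N}<\frac{2\log(1-p_A)}{N},$$ then $\xi_<(a,\sigma_1)>\tfrac12$ for every $a\ge0$. (Here $\xi(a,\sigma_1)>1/2$ means that a point $x_1$ with $\|x_1-x_0\|=a$ smoothed with standard deviation $\sigma_1$ cannot be certified from $x_0$ smoothed with $\sigma_0$ and top-class probability $p_A$.)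
   Context: $\chi^2_N(\lambda,x)=\mathbb{P}(\|Z+\mu\|^2\le x)$ for $Z\sim\mathcal{N}(0,I_N)$, $\|\mu\|^2=\lambda\ge 0$ (noncentral chi-squared cdf), and $\chi^2_{N,qf}(\lambda,p)=\inf\{x:\chi^2_N(\lambda,x)\ge p\}$ for $p\in(0,1)$ its quantile function. Fix $N$, $\sigma_0>0$, $p_A\in(0,1)$. For $a\ge0$ and $0<\sigma_1<\sigma_0$ define $$\xi_>(a,\sigma_1)=\chi^2_N\!\left(\frac{\sigma_1^2a^2}{(\sigma_0^2-\sigma_1^2)^2},\ \frac{\sigma_0^2}{\sigma_1^2}\chi^2_{N,qf}\!\left(\frac{\sigma_0^2a^2}{(\sigma_0^2-\sigma_1^2)^2},1-p_A\right)\right),$$ and for $\sigma_1>\sigma_0$ define $$\xi_<(a,\sigma_1)=1-\chi^2_N\!\left(\frac{\sigma_1^2a^2}{(\sigma_1^2-\sigma_0^2)^2},\ \frac{\sigma_0^2}{\sigma_1^2}\chi^2_{N,qf}\!\left(\frac{\sigma_0^2a^2}{(\sigma_1^2-\sigma_0^2)^2},p_A\right)\right).$$ These equal the maximal probability $\mathbb{P}(f(Y_1)=B)$, $Y_1\sim\mathcal N(x_1,\sigma_1^2 I_N)$, over binary classifiers $f$ with $\mathbb{P}(f(Y_0)=B)\le 1-p_A$, $Y_0\sim\mathcal N(x_0,\sigma_0^2I_N)$, where $a=\|x_1-x_0\|$. *)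

(* Defs.v *)
From mathcomp Require Import all_boot all_order all_algebra.
From mathcomp Require Import all_classical all_reals all_analysis.
Set Implicit Arguments. Unset Strict Implicit. Unset Printing Implicit Defensive.
Import Order.TTheory GRing.Theory Num.Theory.
Local Open Scope classical_set_scope.
Local Open Scope ring_scope.

Section Chi2.
Variable R : realType.

Definition phi (z : R) : R := normal_pdf 0 1 z.

(* Central chi-squared cdf with k degrees of freedom, written as an iterated
   integral: C_0 x = [0 <= x], C_{k+1} x = int phi(z) C_k (x - z^2) dz,
   i.e. C_k x = P(Z_1^2 + ... + Z_k^2 <= x) with Z_i iid N(0,1). *)
Fixpoint chi2c (k : nat) (x : R) : R :=
  match k with
  | O => if 0 <= x then 1 else 0
  | S k' => Rintegral lebesgue_measure setT
              (fun z => phi z * chi2c k' (x - z ^+ 2))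
  end.

(* Noncentral chi-squared cdf chi2_N(lam, x) = P(||Z + mu||^2 <= x) with
   Z ~ N(0, I_N) and mu = (sqrt lam, 0, ..., 0) (so ||mu||^2 = lam), written
   as the iterated (Fubini) integral over the first coordinate. For N = 0 the
   value is the degenerate [0 <= x] (never used below, N >= 2). *)
Definition chi2 (N : nat) (lam x : R) : R :=
  match N with
  | O => if 0 <= x then 1 else 0
  | S k => Rintegral lebesgue_measure setT
             (fun z => phi z * chi2c k (x - (z + Num.sqrt lam) ^+ 2))
  end.

Definition chi2_qf (N : nat) (lam p : R) : R :=
  inf [set x : R | p <= chi2 N lam x].

Definition xi_gt (N : nat) (s0 pA a s1 : R) : R :=
  chi2 N (s1 ^+ 2 * a ^+ 2 / (s0 ^+ 2 - s1 ^+ 2) ^+ 2)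
    (s0 ^+ 2 / s1 ^+ 2 *
     chi2_qf N (s0 ^+ 2 * a ^+ 2 / (s0 ^+ 2 - s1 ^+ 2) ^+ 2) (1 - pA)).

Definition xi_lt (N : nat) (s0 pA a s1 : R) : R :=
  1 - chi2 N (s1 ^+ 2 * a ^+ 2 / (s1 ^+ 2 - s0 ^+ 2) ^+ 2)
    (s0 ^+ 2 / s1 ^+ 2 *
     chi2_qf N (s0 ^+ 2 * a ^+ 2 / (s1 ^+ 2 - s0 ^+ 2) ^+ 2) pA).

End Chi2.

(* Main.v *)
(** Write chi2 as the mass of a ball under a shifted Gaussian. The ball in the
    definition of xi is centred where the likelihood ratio of the two Gaussians is
    a function of |y| alone, so by Neyman-Pearson it can be compared with any
    competing ball. A ball around the mean of the law of Y_1, of squared radius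
    N s1^2, has mass at least 1/2 for that law (the median of chi^2_N is at most
    N), and for the law of Y_0 a Chernoff bound makes its mass less than 1 - pA:
    this is case (1). In case (2) the ball around the mean of the law of Y_0 of
    squared radius (N - 1) s1^2 plays the same role (the median of chi^2_N is at
    least N - 1), provided t = (s1/s0)^2 (N - 1)/N is at least 1; when t < 1
    the hypothesis forces pA < 1/2 and the ball of mass pA around that mean works.

    No product measure is needed: all comparisons of balls are proved for the
    iterated integrals by induction on the dimension, and comparing with the
    volume of balls gives the density of the chi distribution, hence its
    medians. *)
Require Import Defs.
From mathcomp Require Import all_boot all_order all_algebra.
From mathcomp Require Import all_classical all_reals all_analysis.
From mathcomp Require Import measurable_realfun ring lra.
Set Implicit Arguments. Unset Strict Implicit. Unset Printing Implicit Defensive.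
Import Order.TTheory GRing.Theory Num.Theory.
Import numFieldNormedType.Exports.
Local Open Scope ring_scope.

Notation mu := (@lebesgue_measure _).
Notation rintegral f := (Rintegral (@lebesgue_measure _) setT f).
Notation rintegrable f :=
  ((@lebesgue_measure _).-integrable setT (EFin \o f)).

(** * Change of variables and integrability for real-valued Lebesgue integrals *)

Section RealIntegrals.
Local Open Scope classical_set_scope.
Local Open Scope ring_scope.
Variable R : realType.
Implicit Types (f g : R -> R) (c d : R).

Let affine c d : measurableTypeR R -> measurableTypeR R := fun x => c * x + d.

Let measurable_affine c d : measurable_fun setT (affine c d).
Proof.
have : measurable_fun [set: R] (fun x : R => c * x + d).
  by apply: measurable_funD => //; exact: measurable_funM.
exact.
Qed.

Let affine_image c d : {measure set (measurableTypeR R) -> \bar R}.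
Proof.
unshelve refine (pushforward mu (affine c d) : {measure set _ -> \bar R}).
exact: measurable_affine.
Defined.

(** The two measures agree on half-open intervals, which determine Lebesgue measure. *)
Let lebesgue_measure_affine c d (c0 : 0 < c) (A : set R) : measurable A ->
  mscale (NngNum (ltW c0)) (affine_image c d) A = mu A.
Proof.
move=> mA; apply/esym/lebesgue_measure_unique => //= _ [[a b]] _ <-.
rewrite /mscale/= /pushforward.
rewrite (_ : affine c d @^-1` _ =
             `](a - d) / c, (b - d) / c]%classic); last first.
  apply/seteqP; split => x /=; rewrite !in_itv/= /affine;
    by rewrite ltr_pdivrMr// ler_pdivlMr// ltrBlDr lerBrDr mulrC.
rewrite !lebesgue_measure_itv/= !lte_fin ltr_pM2r ?invr_gt0// ltrD2r.
case: ifPn => _; last by rewrite mule0.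
by rewrite -!EFinD -EFinM; congr (_%:E); field; lra.
Qed.

Lemma rintegral_affine f c d : 0 < c -> measurable_fun setT f ->
  (forall x, 0 <= f x) ->
  rintegral f = c * rintegral (fun x => f (c * x + d)).
Proof.
move=> c0 mf f0; rewrite /Rintegral.
have -> : (\int[mu]_x (f x)%:E =
    \int[mscale (NngNum (ltW c0)) (affine_image c d)]_x (f x)%:E)%E.
  by apply: eq_measure_integral => A mA _; exact/esym/lebesgue_measure_affine.
have mEf : measurable_fun [set: R] (EFin \o f) by exact/measurable_EFinP.
rewrite ge0_integral_mscale//=; last by move=> x _; rewrite lee_fin.
rewrite ge0_integral_pushforward//=; last by move=> x _; rewrite lee_fin.
rewrite preimage_setT /comp/= /affine.
(* [fine] sends both infinities to 0, so the identity survives a divergent integral and no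
   integrability has to be assumed. *)
case: (\int[mu]_x _)%E => //=; first by rewrite gt0_muley ?lte_fin//= mulr0.
by rewrite gt0_muleNy ?lte_fin//= mulr0.
Qed.

Lemma rintegral_opp f : measurable_fun setT f -> (forall x, 0 <= f x) ->
  rintegral f = rintegral (fun x => f (- x)).
Proof.
move=> mf f0; rewrite /Rintegral; congr fine.
have -> : (\int[mu]_x (f x)%:E =
    \int[pushforward mu (-%R : _ -> measurableTypeR R)]_x (f x)%:E)%E.
  by apply: eq_measure_integral => A mA _; exact/esym/lebesgue_measureN.
rewrite ge0_integral_pushforward//; last by move=> x _; rewrite lee_fin.
exact/measurable_EFinP.
Qed.

Lemma rintegrable_le {f} g : measurable_fun setT f ->
  (forall x, `|f x| <= g x) -> rintegrable g -> rintegrable f.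
Proof.
move=> mf fg ig; apply: le_integrable ig => //; first exact/measurable_EFinP.
move=> x _; rewrite /= lee_fin (le_trans (fg x))//; exact: ler_norm.
Qed.

Lemma rintegrableZ c f : rintegrable f -> rintegrable (fun x => c * f x).
Proof. by move=> fi; exact: (integrableZl measurableT c fi). Qed.

Lemma rintegrableB f g : rintegrable f -> rintegrable g ->
  rintegrable (fun x => f x - g x).
Proof. by move=> fi gi; exact: (integrableB measurableT fi gi). Qed.

Lemma rintegralZ c f : rintegrable f ->
  rintegral (fun x => c * f x) = c * rintegral f.
Proof. by move=> ?; rewrite RintegralZl. Qed.

Lemma rintegralB f g : rintegrable f -> rintegrable g ->
  rintegral (fun x => f x - g x) = rintegral f - rintegral g.
Proof. by move=> ? ?; rewrite RintegralB. Qed.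

Lemma rintegral_le f g : rintegrable f -> rintegrable g ->
  (forall x, f x <= g x) -> rintegral f <= rintegral g.
Proof. by move=> ? ? fg; apply: le_Rintegral => // x _. Qed.

Lemma eq_rintegral f g : f =1 g -> rintegral f = rintegral g.
Proof. by move=> fg; congr Rintegral; apply/funext. Qed.

(** Outside a compact interval around [a] the argument of [g] is negative; inside it, monotonicity
    bounds the integrand by [M * g x]. *)
Lemma rintegrable_bump (v g : R -> R) (M a x : R) :
  measurable_fun setT v -> (forall u, `|v u| <= M) ->
  (forall y, 0 <= g y) -> (forall y, y < 0 -> g y = 0) ->
  {homo g : y z / y <= z} ->
  rintegrable (fun u => v u * g (x - (u - a) ^+ 2)).
Proof.
move=> mv vM g0 gN gh.
have M0 : 0 <= M by exact: le_trans (vM 0).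
pose I := `[a - (1 + `|x|), a + (1 + `|x|)]%classic : set R.
apply: (@rintegrable_le _ (fun u => (M * g x) * \1_I u)).
- apply: measurable_funM => //; apply: measurableT_comp => //.
    exact: nondecreasing_measurable.
  apply: measurable_funB => //; apply: measurable_funX.
  exact: measurable_funB.
- move=> u; rewrite normrM (ger0_norm (g0 _)) indicE.
  case: (boolP (u \in I)) => uI; last first.
    rewrite gN ?mulr0//.
    move: uI; rewrite notin_setE /I/= in_itv/= => /negP.
    rewrite negb_and -!ltNge => /orP[] h; have := ler_norm x;
      have := normr_ge0 x => *; nra.
  rewrite mulr1 ler_pM// gh// lerBlDr lerDl.
  exact: sqr_ge0.
- apply: rintegrableZ; exact: integrable_indic_itv.
Qed.

End RealIntegrals.

(** * Product weights and the masses they give to balls *)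

Section BallMass.
Variable R : realType.
Implicit Types (w v : R -> R) (x y z : R) (k : nat).

(* The mass that the k-fold product of the weight [w] gives to the ball of
   squared radius [x]. *)
Fixpoint ball_mass w k x : R :=
  match k with
  | O => if 0 <= x then 1 else 0
  | S k' => rintegral (fun z => w z * ball_mass w k' (x - z ^+ 2))
  end.

Lemma chi2cE k x : chi2c k x = ball_mass (@phi R) k x.
Proof. by elim: k x => //= k IH x; apply: eq_rintegral => z; rewrite IH. Qed.

(** Boundedness rather than integrability, so that the constant weight 1, whose ball masses are
    volumes, is covered along with Gaussian densities. *)
Definition bounded_weight w :=
  measurable_fun setT w /\ exists M, forall z, 0 <= w z <= M.

Lemma bounded_weight_ge0 w z : bounded_weight w -> 0 <= w z.
Proof. by move=> [_ [M /(_ z)/andP[]]]. Qed.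

(** Proved jointly, since integrability in the next dimension uses all three facts. *)
Let ball_mass_spec w k : bounded_weight w ->
  [/\ forall x, 0 <= ball_mass w k x,
      forall x, x < 0 -> ball_mass w k x = 0 &
      {homo ball_mass w k : x y / x <= y}].
Proof.
move=> bw; elim: k => [|k [ge0 neg0 homo]].
  split=> [x|x|x y xy] /=.
  - by case: ifP.
  - by rewrite leNgt => ->.
  - case: ifP => x0; last by case: ifP.
    by rewrite (le_trans x0 xy).
have int x : rintegrable (fun z => w z * ball_mass w k (x - z ^+ 2)).
  case: bw => mw [M hM].
  have := @rintegrable_bump R w (ball_mass w k) M 0 x mw.
  under [X in _ -> _ -> _ -> _ -> rintegrable X]eq_fun do rewrite subr0.
  by apply=> // u; have /andP[? ?] := hM u; rewrite ger0_norm.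
split=> [x|x x0|x y xy] /=.
- by apply: Rintegral_ge0 => z _; rewrite mulr_ge0 ?(bounded_weight_ge0 _ bw).
- rewrite (@eq_rintegral _ _ (cst 0)) ?/Rintegral ?integral0// => z.
  by rewrite neg0 ?mulr0//; have := sqr_ge0 z; lra.
- apply: rintegral_le => // z.
  by rewrite ler_wpM2l ?(bounded_weight_ge0 _ bw)// homo// lerD2r.
Qed.

Section Properties.
Variables (w : R -> R) (k : nat).
Hypothesis bw : bounded_weight w.

Lemma ball_mass_ge0 x : 0 <= ball_mass w k x.
Proof. by have [] := ball_mass_spec k bw. Qed.

Lemma ball_mass_lt0 x : x < 0 -> ball_mass w k x = 0.
Proof. by have [_ h _] := ball_mass_spec k bw; apply: h. Qed.

Lemma ball_mass_homo : {homo ball_mass w k : x y / x <= y}.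
Proof. by have [] := ball_mass_spec k bw. Qed.

Lemma measurable_ball_mass (a x : R) :
  measurable_fun setT (fun u : R => ball_mass w k (x - (u - a) ^+ 2)).
Proof.
apply: measurableT_comp; first exact: nondecreasing_measurable ball_mass_homo.
by apply: measurable_funB => //; apply: measurable_funX; exact: measurable_funB.
Qed.

Lemma rintegrable_ball_mass_center v a x : bounded_weight v ->
  rintegrable (fun u => v u * ball_mass w k (x - (u - a) ^+ 2)).
Proof.
move=> [mv [M hM]]; apply: (rintegrable_bump (M := M)) => //.
- by move=> u; have /andP[? ?] := hM u; rewrite ger0_norm.
- exact: ball_mass_ge0.
- exact: ball_mass_lt0.
- exact: ball_mass_homo.
Qed.

Lemma rintegrable_ball_mass v x : bounded_weight v ->
  rintegrable (fun u => v u * ball_mass w k (x - u ^+ 2)).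
Proof.
move=> /(@rintegrable_ball_mass_center v 0 x).
by under [X in rintegrable X -> _]eq_fun do rewrite subr0.
Qed.

End Properties.

(** The substitution [z = c * u] contributes one factor [r * c] per coordinate. *)
Lemma ball_mass_scale w c r k x : bounded_weight w -> 0 < c -> 0 <= r ->
  ball_mass (fun z => r * w (z / c)) k x =
  (r * c) ^+ k * ball_mass w k (x / c ^+ 2).
Proof.
move=> bw c0 r0; elim: k x => [|k IH] x /=.
  by rewrite mul1r pmulr_lge0// invr_gt0 exprn_gt0.
under eq_rintegral do rewrite IH.
have mwc : measurable_fun setT (fun z : R => w (z / c)).
  apply: measurableT_comp; first by case: bw.
  exact: measurable_funM.
rewrite (@rintegral_affine _ _ c 0)//; last 2 first.
- apply: measurable_funM; first exact: measurable_funM.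
  apply: measurable_funM => //.
  apply: measurableT_comp.
    by apply: nondecreasing_measurable => // y z; exact: ball_mass_homo.
  by apply: measurable_funM => //; apply: measurable_funB => //; exact: measurable_funX.
- move=> z; rewrite !mulr_ge0 ?(bounded_weight_ge0 _ bw) ?ball_mass_ge0//.
  by rewrite exprn_ge0// mulr_ge0// ltW.
have -> : (fun z => r * w ((c * z + 0) / c) * ((r * c) ^+ k *
      ball_mass w k ((x - (c * z + 0) ^+ 2) / c ^+ 2))) =
    (fun z => (r * (r * c) ^+ k) *
      (w z * ball_mass w k (x / c ^+ 2 - z ^+ 2))).
  apply/funext => z; rewrite addr0 (_ : c * z / c = z); last by field; lra.
  by rewrite (_ : (x - (c * z) ^+ 2) / c ^+ 2 = x / c ^+ 2 - z ^+ 2);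
    [ring | field; lra].
rewrite rintegralZ; last exact: rintegrable_ball_mass.
by rewrite !mulrA [_ ^+ k.+1]exprS [c * r]mulrC.
Qed.

(* Both bounds are propagated by the recursion because the Gaussian factor
   [expR (- kappa * z ^+ 2)] completes [expR (- kappa * (x - z ^+ 2))] to
   [expR (- kappa * x)]. *)
Lemma ball_mass_compare w0 w1 rho kappa k x y :
  bounded_weight w0 -> bounded_weight w1 -> 0 <= rho -> 0 <= kappa ->
  (forall z, w1 z = rho * expR (- kappa * z ^+ 2) * w0 z) -> x <= y ->
  rho ^+ k * expR (- kappa * y) * (ball_mass w0 k y - ball_mass w0 k x)
  <= ball_mass w1 k y - ball_mass w1 k x
  <= rho ^+ k * expR (- kappa * x) * (ball_mass w0 k y - ball_mass w0 k x).
Proof.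
move=> bw0 bw1 r0 k0 w10; elim: k x y => [|k IH] x y xy.
  rewrite /= expr0 !mul1r.
  case: (leP 0 x) => x0; first by rewrite (le_trans x0 xy) subrr !mulr0 lexx.
  case: (leP 0 y) => y0; last by rewrite subrr !mulr0 lexx.
  rewrite subr0 !mulr1 -expR0 !ler_expR; apply/andP; split; nra.
have expE u z : rho ^+ k.+1 * expR (- kappa * u) =
    rho * expR (- kappa * z ^+ 2) * (rho ^+ k * expR (- kappa * (u - z ^+ 2))).
  rewrite (_ : - kappa * u = - kappa * z ^+ 2 + - kappa * (u - z ^+ 2)).
    by rewrite expRD exprS; ring.
  ring.
rewrite /= -!rintegralB; try exact: rintegrable_ball_mass.
have i0 u : rintegrable (fun z => w0 z * ball_mass w0 k (u - z ^+ 2)).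
  exact: rintegrable_ball_mass.
have i1 u : rintegrable (fun z => w1 z * ball_mass w1 k (u - z ^+ 2)).
  exact: rintegrable_ball_mass.
have ci z : 0 <= rho * expR (- kappa * z ^+ 2) * w0 z.
  by rewrite -w10 bounded_weight_ge0.
rewrite -!rintegralZ; try exact: rintegrableB.
have H z := IH (x - z ^+ 2) (y - z ^+ 2) (lerB xy (lexx _)).
apply/andP; split; apply: rintegral_le; try exact: rintegrableB;
  try (by apply: rintegrableZ; exact: rintegrableB) => z.
- move=> z; have /andP[h _] := H z; move: (ler_wpM2l (ci z) h).
  by rewrite (expE y z) w10; congr (_ <= _); ring.
- move=> z; have /andP[_ h] := H z; move: (ler_wpM2l (ci z) h).
  by rewrite (expE x z) w10; congr (_ <= _); ring.
Qed.

End BallMass.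

(** * Gaussian weights, chi-squared cdfs and Chernoff bounds *)

Section ChiSquared.
Variable R : realType.
Implicit Types (x y z b c s : R) (k : nat).

Lemma phiE z : phi z = normal_peak 1 * expR (- z ^+ 2 / 2).
Proof.
rewrite /phi normal_pdfE ?oner_neq0// /normal_fun.
by rewrite subr0 expr1n.
Qed.

Lemma phi_ge0 z : 0 <= phi z.
Proof. exact: normal_pdf_ge0. Qed.

Lemma phiN z : phi (- z) = phi z.
Proof. by rewrite !phiE sqrrN. Qed.

Lemma phi_le y z : y ^+ 2 <= z ^+ 2 -> phi z <= phi y.
Proof.
by move=> yz; rewrite !phiE ler_wpM2l ?normal_peak_ge0// ler_expR; lra.
Qed.

Lemma measurable_phi : measurable_fun setT (@phi R).
Proof. exact: measurable_normal_pdf. Qed.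

Lemma bounded_weight_phi : bounded_weight (@phi R).
Proof.
split; first exact: measurable_phi.
by exists (phi 0) => z; rewrite phi_ge0 phi_le// expr0n/= sqr_ge0.
Qed.

Lemma bounded_weight_gauss s b : 0 < s ->
  bounded_weight (fun z => s^-1 * phi ((z - b) / s)).
Proof.
move=> s0; split.
  apply: measurable_funM => //; apply: measurableT_comp.
    exact: measurable_phi.
  by apply: measurable_funM => //; exact: measurable_funB.
exists (s^-1 * phi 0) => z.
rewrite mulr_ge0 ?invr_ge0 ?(ltW s0) ?phi_ge0//=.
by rewrite ler_wpM2l ?invr_ge0 ?(ltW s0)// phi_le// expr0n/= sqr_ge0.
Qed.

Lemma rintegrable_phi : rintegrable (@phi R).
Proof. exact: integrable_normal_pdf. Qed.

Lemma rintegral_phi : rintegral (@phi R) = 1.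
Proof. by rewrite /Rintegral integral_normal_pdf ?oner_neq0. Qed.

Lemma rintegrable_phi_scale c : 0 < c -> rintegrable (fun z => phi (c * z)).
Proof.
move=> c0; have cV : c^-1 != 0 by rewrite invr_neq0// gt_eqF.
have := rintegrableZ (normal_peak 1 / normal_peak c^-1)
  (integrable_normal_pdf 0 c^-1).
rewrite (_ : (fun x => _) = (fun z => phi (c * z)))//.
apply/funext => z.
rewrite phiE normal_pdfE//= mulrA divfK; last first.
  by rewrite gt_eqF// normal_peak_gt0.
congr (_ * expR _); rewrite subr0 exprMn exprVn; field.
by rewrite gt_eqF.
Qed.

Lemma rintegral_phi_scale c : 0 < c -> rintegral (fun z => phi (c * z)) = c^-1.
Proof.
move=> c0; apply: (mulfI (lt0r_neq0 c0)); rewrite divff ?gt_eqF//.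
rewrite -rintegral_phi (@rintegral_affine _ (@phi R) c 0)//; last 2 first.
- exact: measurable_phi.
- exact: phi_ge0.
by congr (_ * _); apply: eq_rintegral => z; rewrite addr0.
Qed.

Lemma chi2c_ge0 k x : 0 <= chi2c k x.
Proof. by rewrite chi2cE ball_mass_ge0//; exact: bounded_weight_phi. Qed.

Lemma chi2c_lt0 k x : x < 0 -> chi2c k x = 0.
Proof. by move=> ?; rewrite chi2cE ball_mass_lt0//; exact: bounded_weight_phi. Qed.

Lemma chi2c_homo k : {homo @chi2c R k : x y / x <= y}.
Proof. by move=> x y xy; rewrite !chi2cE ball_mass_homo//; exact: bounded_weight_phi. Qed.

Lemma rintegrable_chi2c k a x :
  rintegrable (fun u => phi u * chi2c k (x - (u - a) ^+ 2)).
Proof.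
under [X in rintegrable X]eq_fun do rewrite chi2cE.
by apply: rintegrable_ball_mass_center; exact: bounded_weight_phi.
Qed.

(** Noncentral cdf with [k + 1] degrees of freedom, parametrised by the shift [b] of either sign
    instead of its square. *)
Definition chi2_shift k b x :=
  rintegral (fun z => phi z * chi2c k (x - (z + b) ^+ 2)).

Lemma chi2E k l x : chi2 k.+1 l x = chi2_shift k (Num.sqrt l) x.
Proof. by []. Qed.

Lemma chi2cS k x : chi2c k.+1 x = chi2_shift k 0 x.
Proof. by apply: eq_rintegral => z; rewrite addr0. Qed.

Lemma rintegrable_chi2_shift k b x :
  rintegrable (fun z => phi z * chi2c k (x - (z + b) ^+ 2)).
Proof.
by have := rintegrable_chi2c k (- b) x;
  under [X in rintegrable X -> _]eq_fun do rewrite opprK.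
Qed.

Lemma chi2c_le1 k x : chi2c k x <= 1.
Proof.
elim: k x => [|k IH] x /=; first by case: ifP.
rewrite -rintegral_phi; apply: rintegral_le => [||z].
- have := rintegrable_chi2c k 0 x.
  by under [X in rintegrable X -> _]eq_fun do rewrite subr0.
- exact: rintegrable_phi.
- by rewrite -[leRHS]mulr1 ler_wpM2l ?phi_ge0.
Qed.

(** The Chernoff bound E[exp(h (x - |Z|^2))] with h = (c^2 - 1) / 2, for which each of the [k]
    coordinates contributes a factor 1 / c. *)
Let tilt c k x : R := expR ((c ^+ 2 - 1) * x / 2) * c ^- k.

Let tilt_split c k x z : 0 < c ->
  phi z * tilt c k (x - z ^+ 2) =
  (expR ((c ^+ 2 - 1) * x / 2) * c ^- k) * phi (c * z).
Proof.
move=> c0; rewrite /tilt !phiE.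
have -> : - (c * z) ^+ 2 / 2 = - z ^+ 2 / 2 - (c ^+ 2 - 1) * z ^+ 2 / 2 by field.
have -> : (c ^+ 2 - 1) * (x - z ^+ 2) / 2 =
  (c ^+ 2 - 1) * x / 2 - (c ^+ 2 - 1) * z ^+ 2 / 2 by field.
by rewrite !expRD; ring.
Qed.

Let rintegrable_tilt c k x : 0 < c ->
  rintegrable (fun z => phi z * tilt c k (x - z ^+ 2)).
Proof.
move=> c0; under [X in rintegrable X]eq_fun do rewrite tilt_split//.
by apply: rintegrableZ; exact: rintegrable_phi_scale.
Qed.

Let rintegral_tilt c k x : 0 < c ->
  rintegral (fun z => phi z * tilt c k (x - z ^+ 2)) = tilt c k.+1 x.
Proof.
move=> c0; under eq_rintegral do rewrite tilt_split//.
rewrite rintegralZ; last exact: rintegrable_phi_scale.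
by rewrite rintegral_phi_scale// /tilt [c ^+ k.+1]exprSr invfM mulrA
  [_ / c ^+ k]mulrC mulrAC mulrC mulrA.
Qed.

Let rintegrable_chi2c0 k x :
  rintegrable (fun u => phi u * chi2c k (x - u ^+ 2)).
Proof.
have := rintegrable_chi2c k 0 x.
by under [X in rintegrable X -> _]eq_fun do rewrite subr0.
Qed.

(** In dimension 0 the exponential dominates the indicator of [0 <= x]; integrating the bound over
    one coordinate reproduces it in the next dimension. *)
Lemma chi2c_chernoff c k x : 1 <= c ->
  chi2c k x <= expR ((c ^+ 2 - 1) * x / 2) * c ^- k.
Proof.
move=> c1; have c0 : 0 < c by lra.
rewrite -/(tilt c k x); elim: k x => [|k IH] x /=.
  rewrite /tilt expr0 invr1 mulr1; case: ifP => x0; last exact: expR_ge0.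
  by rewrite -[leLHS]expR0 ler_expR divr_ge0// mulr_ge0// subr_ge0 exprn_ege1.
rewrite -rintegral_tilt//; apply: rintegral_le => [||z] //.
  exact: rintegrable_tilt.
by rewrite ler_wpM2l ?phi_ge0.
Qed.

(** For [c <= 1] the exponent changes sign, so the exponential dominates the indicator of [x < 0]
    and the same induction bounds the complement. *)
Lemma chi2c_upper_chernoff c k x : 0 < c <= 1 ->
  1 - chi2c k x <= expR ((c ^+ 2 - 1) * x / 2) * c ^- k.
Proof.
move=> /andP[c0 c1]; rewrite -/(tilt c k x); elim: k x => [|k IH] x /=.
  rewrite /tilt expr0 invr1 mulr1; case: ifPn => x0.
    by rewrite subrr expR_ge0.
  rewrite subr0 -[leLHS]expR0 ler_expR divr_ge0//; rewrite -ltNge in x0.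
  by rewrite mulr_le0// ?(ltW x0)// subr_le0 exprn_ile1// ltW.
rewrite -rintegral_tilt// -rintegral_phi -rintegralB//; last first.
  exact: rintegrable_phi.
apply: rintegral_le => [||z].
- by apply: rintegrableB => //; exact: rintegrable_phi.
- exact: rintegrable_tilt.
- by rewrite -[X in X - _]mulr1 -mulrBr ler_wpM2l ?phi_ge0.
Qed.

End ChiSquared.

(** * Noncentral cdfs: comparison with the central case, continuity and quantiles *)

Section Quantiles.
Variable R : realType.
Implicit Types (x y z b c s p : R) (k : nat).

Lemma rintegral_reflect (f : R -> R) b : measurable_fun setT f ->
  (forall x, 0 <= f x) -> rintegral f = rintegral (fun u => f (b - u)).
Proof.
move=> mf f0; rewrite rintegral_opp// (@rintegral_affine _ _ 1 (- b))//.
- by rewrite mul1r; apply: eq_rintegral => u; congr f; ring.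
- exact: measurableT_comp.
Qed.

(* With [g u := chi2c k (x - u ^+ 2)], reflecting [u] into [b - u] turns twice
   the difference of the two masses into the integral of
   [(phi u - phi (u - b)) * (g u - g (b - u))], whose factors have the same
   sign. *)
Lemma chi2_shift_le k b x : chi2_shift k b x <= chi2c k.+1 x.
Proof.
have half (A B : R) : 0 <= (A - B) - (B - A) -> B <= A by lra.
pose g (u : R) := chi2c k (x - u ^+ 2).
have g0 u : 0 <= g u by exact: chi2c_ge0.
have mg : measurable_fun setT g.
  apply: measurableT_comp; last by apply: measurable_funB => //; exact: measurable_funX.
  by apply: nondecreasing_measurable => // y z; exact: chi2c_homo.
have mphi := @measurable_phi R.
have gle u v : u ^+ 2 <= v ^+ 2 -> g v <= g u.
  by move=> uv; apply: chi2c_homo; lra.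
have bpsi : bounded_weight (fun u => phi (u - b)).
  have := @bounded_weight_gauss R 1 b ltr01.
  by under [X in bounded_weight X -> _]eq_fun do rewrite invr1 mul1r mulr1.
have int v a : bounded_weight v ->
    rintegrable (fun u => v u * chi2c k (x - (u - a) ^+ 2)).
  move=> bv; under [X in rintegrable X]eq_fun do rewrite chi2cE.
  by apply: rintegrable_ball_mass_center => //; exact: bounded_weight_phi.
have int0 v : bounded_weight v -> rintegrable (fun u => v u * g u).
  by move=> /(int _ 0); under [X in rintegrable X -> _]eq_fun do rewrite subr0.
have intb v : bounded_weight v -> rintegrable (fun u => v u * g (b - u)).
  move=> /(int _ b).
  by under [X in rintegrable X -> _]eq_fun do rewrite -sqrrN opprB.
have bphi := bounded_weight_phi R.
have mpsi := bpsi.1.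
have A1 : chi2c k.+1 x = rintegral (fun u => phi u * g u) by [].
have A2 : chi2c k.+1 x = rintegral (fun u => phi (u - b) * g (b - u)).
  rewrite A1 (@rintegral_reflect _ b); last first.
  - by move=> u; rewrite mulr_ge0 ?phi_ge0.
  - exact: measurable_funM.
  by apply: eq_rintegral => u; rewrite -phiN opprB.
have B1 : chi2_shift k b x = rintegral (fun u => phi (u - b) * g u).
  rewrite (@rintegral_affine _ _ 1 b)//; last first.
  - by move=> u; rewrite mulr_ge0 ?phi_ge0.
  - exact: measurable_funM.
  by rewrite mul1r; apply: eq_rintegral => u; rewrite mul1r addrK.
have B2 : chi2_shift k b x = rintegral (fun u => phi u * g (b - u)).
  rewrite B1 (@rintegral_reflect _ b); last first.
  - by move=> u; rewrite mulr_ge0 ?phi_ge0.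
  - exact: measurable_funM.
  by apply: eq_rintegral => u; rewrite -phiN; congr (phi _ * _); ring.
have : 0 <= (rintegral (fun u => phi u * g u)
      - rintegral (fun u => phi (u - b) * g u))
   - (rintegral (fun u => phi u * g (b - u))
      - rintegral (fun u => phi (u - b) * g (b - u))).
  rewrite -!rintegralB; try exact: int0; try exact: intb;
    try (apply: rintegrableB; exact: int0);
    try (apply: rintegrableB; exact: intb).
  apply: Rintegral_ge0 => u _.
  rewrite (_ : _ - _ = (phi u - phi (u - b)) * (g u - g (b - u))); last by ring.
  have [h|/ltW h] := leP (u ^+ 2) ((u - b) ^+ 2).
  - rewrite mulr_ge0// subr_ge0; first exact: phi_le.
    by apply: gle; rewrite -[X in _ <= X]sqrrN opprB.
  - rewrite mulr_le0// subr_le0; first exact: phi_le.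
    by apply: gle; rewrite -[X in X <= _]sqrrN opprB.
by rewrite -A1 -B1 -B2 -A2; exact: half.
Qed.

Let c1 : bounded_weight (cst 1 : R -> R).
Proof. by split => //; exists 1 => z /=; rewrite ler01 lexx. Qed.

(** In dimension one the ball is an interval of length proportional to its radius. *)
Let ball1_sqr x : 0 < x ->
  ball_mass (cst 1) 1 x = Num.sqrt x * ball_mass (cst 1) 1 (1 : R).
Proof.
move=> x0; have s0 : 0 < Num.sqrt x by rewrite sqrtr_gt0.
have := ball_mass_scale 1 x c1 s0 ler01.
rewrite expr1 mul1r sqr_sqrtr ?(ltW x0)// divff ?gt_eqF// => <-.
by congr ball_mass; apply/funext => z /=; rewrite mulr1.
Qed.

Let ball1_modulus x y : x < y ->
  ball_mass (cst 1) 1 y - ball_mass (cst 1) 1 x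
  <= Num.sqrt (y - x) * ball_mass (cst 1) 1 (1 : R).
Proof.
move=> xy; have V0 := ball_mass_ge0 1 c1 1.
have [x0|x0] := ltP x 0.
  rewrite (ball_mass_lt0 _ c1 x0) subr0 -ball1_sqr ?subr_gt0//.
  by apply: ball_mass_homo => //; lra.
have y0 : 0 < y by lra.
have : Num.sqrt x * ball_mass (cst 1) 1 1 <= ball_mass (cst 1) 1 x.
  move: x0; rewrite le_eqVlt => /predU1P[<-|x0]; last by rewrite (ball1_sqr x0).
  by rewrite sqrtr0 mul0r ball_mass_ge0.
rewrite (ball1_sqr y0) => h.
have : (Num.sqrt y - Num.sqrt x) * ball_mass (cst 1) 1 1 <=
       Num.sqrt (y - x) * ball_mass (cst 1) 1 1.
  rewrite ler_wpM2r// -[leLHS]ger0_norm ?subr_ge0 ?ler_sqrt//; try lra.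
  rewrite -ler_sqr ?nnegrE ?sqrtr_ge0// sqr_sqrtr; last lra.
  rewrite real_normK ?num_real// sqrrB !sqr_sqrtr//; try lra.
  suff : x <= Num.sqrt y * Num.sqrt x by lra.
  rewrite -{1}(sqr_sqrtr x0) expr2 ler_wpM2r ?sqrtr_ge0// ler_wsqrtr//; lra.
lra.
Qed.

(** A Hölder constant of exponent 1/2 shared by all the cdfs: in dimension one [phi] is at most
    [phi 0] and the length of the interval is Hölder. *)
Let modulus : R := phi 0 * ball_mass (cst 1) 1 1.

Let modulus_ge0 : 0 <= modulus.
Proof. by rewrite mulr_ge0 ?phi_ge0// ball_mass_ge0. Qed.

Let chi2c1_modulus x y : x < y ->
  chi2c 1 y - chi2c 1 x <= modulus * Num.sqrt (y - x).
Proof.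
move=> xy; have h := ball1_modulus xy.
have bphi := bounded_weight_phi R.
apply: (@le_trans _ _
  (phi 0 * (ball_mass (cst 1) 1 y - ball_mass (cst 1) 1 x))); last first.
  by rewrite /modulus -mulrA ler_wpM2l ?phi_ge0// mulrC.
have i0 v u : bounded_weight v ->
    rintegrable (fun z => v z * ball_mass (cst 1) 0 (u - z ^+ 2)).
  by move=> ?; exact: rintegrable_ball_mass.
rewrite /= -!rintegralB; try exact: (i0 _ _ bphi); try exact: (i0 _ _ c1).
rewrite -rintegralZ; last by apply: rintegrableB; exact: (i0 _ _ c1).
apply: rintegral_le => [||z].
- by apply: rintegrableB; exact: (i0 _ _ bphi).
- by apply/rintegrableZ/rintegrableB; exact: (i0 _ _ c1).
- rewrite -!mulrBr mul1r ler_wpM2r//; last first.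
    by apply: phi_le; rewrite expr0n/= sqr_ge0.
  have := @ball_mass_homo R (cst 1) 0 c1 (x - z ^+ 2) (y - z ^+ 2).
  by rewrite subr_ge0 /=; apply; lra.
Qed.

(** Averaging over the first coordinate against a probability density keeps the modulus, since
    [y - x] is unchanged by a common translation. *)
Let chi2_shift_modulus_step k b :
  (forall x y, x < y -> chi2c k y - chi2c k x <= modulus * Num.sqrt (y - x)) ->
  forall x y, x < y ->
    chi2_shift k b y - chi2_shift k b x <= modulus * Num.sqrt (y - x).
Proof.
move=> IH x y xy.
rewrite -rintegralB; try exact: rintegrable_chi2_shift.
apply: (@le_trans _ _
    (rintegral (fun z : R => (modulus * Num.sqrt (y - x)) * phi z))).
  apply: rintegral_le => [||z].
  - by apply: rintegrableB; exact: rintegrable_chi2_shift.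
  - by apply: rintegrableZ; exact: rintegrable_phi.
  - rewrite -mulrBr mulrC ler_wpM2r ?phi_ge0//.
    set u := (z + b) ^+ 2.
    have -> : y - x = (y - u) - (x - u) by ring.
    by apply: IH; lra.
by rewrite rintegralZ ?rintegral_phi ?mulr1//; exact: rintegrable_phi.
Qed.

Let chi2c_modulus k x y : x < y ->
  chi2c k.+1 y - chi2c k.+1 x <= modulus * Num.sqrt (y - x).
Proof.
elim: k x y => [|k IH] x y xy; first exact: chi2c1_modulus.
by rewrite ![chi2c k.+2 _]chi2cS; exact: chi2_shift_modulus_step.
Qed.

Let chi2_modulus k l x y : x < y ->
  chi2 k.+2 l y - chi2 k.+2 l x <= modulus * Num.sqrt (y - x).
Proof.
move=> xy; rewrite !chi2E; apply: chi2_shift_modulus_step => //.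
exact: chi2c_modulus.
Qed.

Let small_modulus (d : R) : 0 < d ->
  exists2 e, 0 < e & modulus * Num.sqrt e < d.
Proof.
move=> d0; have M1 : 0 < modulus + 1 by rewrite ltr_wpDl.
exists ((d / (modulus + 1)) ^+ 2); first by rewrite exprn_gt0// divr_gt0.
rewrite sqrtr_sqr ger0_norm; last by rewrite divr_ge0// ltW.
by rewrite mulrCA gtr_pMr// ltr_pdivrMr// mul1r; lra.
Qed.

Let chi2_step k l (d : R) : 0 < d ->
  exists2 e, 0 < e & forall x, chi2 k.+2 l (x + e) < chi2 k.+2 l x + d.
Proof.
move=> /small_modulus[e e0 ed]; exists e => // x; rewrite -ltrBlDl.
have xe : x < x + e by rewrite ltrDl.
apply: le_lt_trans (chi2_modulus k l xe) _.
by rewrite (_ : x + e - x = e) ?ed//; ring.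
Qed.

Lemma chi2c_small k (d : R) : 0 < d -> exists2 e, 0 < e & chi2c k.+1 e < d.
Proof.
move=> /small_modulus[e e0 ed]; exists (e / 2); first by lra.
(* The cdf vanishes at [- (e / 2)], so its value at [e / 2] is an increment over length [e]. *)
have /(chi2c_modulus k) : - (e / 2) < e / 2 by lra.
rewrite (_ : e / 2 - - (e / 2) = e); last by field.
by rewrite [X in _ - X]chi2c_lt0; lra.
Qed.

(** Since (z + b)^2 <= 2 z^2 + 2 b^2, a shifted ball contains a centred one. This makes noncentral
    cdfs tend to 1. *)
Lemma chi2_shift_ge k b x :
  chi2c k.+1 ((x - b ^+ 2 *+ 2) / 2) <= chi2_shift k b x.
Proof.
rewrite chi2cS; apply: rintegral_le => [||z].
- exact: rintegrable_chi2_shift.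
- exact: rintegrable_chi2_shift.
- rewrite ler_wpM2l ?phi_ge0// addr0.
  set y := _ - z ^+ 2; have [y0|y0] := ltP y 0.
    by rewrite chi2c_lt0// chi2c_ge0.
  apply: chi2c_homo; move: y0; rewrite /y => y0.
  have := sqr_ge0 (z - b); nra.
Qed.

Lemma chi2c_approx1 k p : p < 1 -> exists y, p <= chi2c k y.
Proof.
move=> p1; set d := 1 - p.
have d0 : 0 < d by rewrite subr_gt0.
pose t : R := 2 ^+ k / d.
have t0 : 0 < t by rewrite divr_gt0// exprn_gt0.
(* Chernoff with c = 1/2 has exponent -3/8 times the argument, here [- t]; then exp(-t) 2^k <= 2^k /
   t = [d]. *)
exists (t * (8 / 3)).
have half : 0 < (1 / 2 : R) <= 1 by apply/andP; split; lra.
have := @chi2c_upper_chernoff R (1 / 2) k (t * (8 / 3)) half.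
have -> : ((1 / 2) ^+ 2 - 1) * (t * (8 / 3)) / 2 = - t :> R by field.
rewrite div1r exprVn invrK expRN => h.
suff : (expR t)^-1 * 2 ^+ k <= d by move: h; rewrite /d; lra.
have et : t <= expR t by have := expR_ge1Dx t; lra.
rewrite mulrC ler_pdivrMr ?expR_gt0//.
rewrite (_ : 2 ^+ k = d * t); first by rewrite ler_wpM2l// ltW.
by rewrite /t mulrCA divff ?mulr1// gt_eqF.
Qed.

Lemma chi2_homo k l : {homo @chi2 R k.+1 l : x y / x <= y}.
Proof.
move=> x y xy; rewrite !chi2E; apply: rintegral_le => [||z];
  try exact: rintegrable_chi2_shift.
by rewrite ler_wpM2l ?phi_ge0// chi2c_homo// lerD2r.
Qed.

Lemma chi2_lt0 k l x : x < 0 -> chi2 k.+1 l x = 0.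
Proof.
move=> x0; apply/eqP; rewrite eq_le; apply/andP; split.
  by rewrite chi2E (le_trans (chi2_shift_le _ _ _))// chi2c_lt0.
by rewrite chi2E; apply: Rintegral_ge0 => z _; rewrite mulr_ge0 ?phi_ge0 ?chi2c_ge0.
Qed.

(** By continuity: were the value at [q] above [p], a smaller point would lie in [S]; were it below,
    no point of [S] would lie close to [q]. *)
Lemma chi2_qfK k l p : 0 < p < 1 -> chi2 k.+2 l (chi2_qf k.+2 l p) = p.
Proof.
move=> /andP[p0 p1]; set q := chi2_qf _ _ _.
pose S := [set x : R | p <= chi2 k.+2 l x]%classic.
have SE x : S x = (p <= chi2 k.+2 l x) by [].
have infS : has_inf S.
  split.
    have [y hy] := chi2c_approx1 k.+2 p1.
    exists (y * 2 + Num.sqrt l ^+ 2 *+ 2); rewrite SE chi2E.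
    apply: (le_trans hy); apply: le_trans (chi2_shift_ge _ _ _).
    by rewrite addrK mulfK// pnatr_eq0.
  exists 0 => x; rewrite SE leNgt => px; rewrite leNgt; apply/negP => x0.
  by move: px; rewrite chi2_lt0// p0.
apply/eqP; rewrite eq_le; apply/andP; split; rewrite leNgt; apply/negP => h.
- have /(chi2_step k l)[e e0 he] : 0 < chi2 k.+2 l q - p by rewrite subr_gt0.
  have := he (q - e); rewrite subrK -ltrBlDr subKr => /ltW pq.
  have := inf_lbound infS.2 pq; rewrite -/q leNgt => /negP; apply.
  by rewrite ltrBlDr ltrDl.
- have /(chi2_step k l)[e e0 he] : 0 < p - chi2 k.+2 l q by rewrite subr_gt0.
  have [x Sx xe] := inf_adherent e0 infS.
  have := he q; rewrite [ltRHS]addrC subrK => /(le_lt_trans (chi2_homo _ _ (ltW xe))).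
  by rewrite ltNge => /negP; apply; rewrite -SE.
Qed.

End Quantiles.

(** * Differentiation by sandwiching, and two exponential inequalities *)

Section Derivatives.
Local Open Scope classical_set_scope.
Local Open Scope ring_scope.
Variable R : realType.
Implicit Types (f g H : R -> R) (x y : R).

(** The difference quotients of [H] and of [g x * f] differ by at most [|g y - g x|] times a
    convergent quotient, which tends to 0. It serves when [H] is an integral of [g] against [f]. *)
Lemma is_derive_sandwich H f g x (df e : R) : 0 < e ->
  (forall y, `|y - x| < e ->
    `|H y - H x - g x * (f y - f x)| <= `|g y - g x| * `|f y - f x|) ->
  {for x, continuous g} -> is_derive x 1 f df -> is_derive x 1 H (g x * df).
Proof.
move=> e0 bound cg [fex fval].
have cx : (h *: 1 + x : R) @[h --> (0 : R)^'] --> x.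
  apply: cvg_within_filter.
  suff : (h *: 1 + x : R) @[h --> (0 : R)] --> 0 * 1 + x by rewrite mul0r add0r.
  by apply: cvgD; [apply: cvgM; [exact: cvg_id|exact: cvg_cst]|exact: cvg_cst].
have cgx : (g (h *: 1 + x)) @[h --> (0 : R)^'] --> g x.
  exact: (cvg_comp _ _ cx cg).
pose q (h : R) := h^-1 * (f (h *: 1 + x) - f x).
have cq : q h @[h --> 0^'] --> df by rewrite -fval; exact: fex.
suff c : (h^-1 *: ((H \o shift x) (h *: 1) - H x)) @[h --> 0^'] --> g x * df.
  by apply: DeriveDef; [exact: cvgP c | exact: (cvg_lim _ c)].
pose r (h : R) := `|g (h *: 1 + x) - g x| * `|q h|.
have cr : r h @[h --> 0^'] --> (0 : R).
  suff : r h @[h --> 0^'] --> `|g x - g x| * `|df|.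
    by rewrite subrr normr0 mul0r.
  apply: cvgM; last exact: cvg_norm.
  by apply: cvg_norm; apply: cvgB => //; exact: cvg_cst.
have cgq : g x * q h @[h --> 0^'] --> g x * df.
  by apply: cvgM => //; exact: cvg_cst.
apply: (@squeeze_cvgr _ _ _ _ (fun h => g x * q h - r h)
   (fun h => g x * q h + r h)).
- near=> h.
  have h0 : h != 0 by near: h; exact: nbhs_dnbhs_neq.
  have hx : `|(h *: 1 + x) - x| < e.
    rewrite addrK (_ : h *: 1 = h); last by rewrite /GRing.scale/= mulr1.
    by near: h; apply: dnbhs0_lt.
  have := bound _ hx => B.
  change (g x * q h - r h <= h^-1 * (H (h *: 1 + x) - H x) <= g x * q h + r h).
  suff : `|h^-1 * (H (h *: 1 + x) - H x) - g x * q h| <= r h.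
    by rewrite ler_norml => /andP[? ?]; apply/andP; split; lra.
  rewrite /r /q [g x * _]mulrCA -mulrBr !normrM [leRHS]mulrCA.
  by rewrite ler_wpM2l.
- suff : (g x * q h - r h) @[h --> 0^'] --> g x * df - 0 by rewrite subr0.
  exact: cvgB.
- suff : (g x * q h + r h) @[h --> 0^'] --> g x * df + 0 by rewrite addr0.
  exact: cvgD.
Unshelve. all: by end_near.
Qed.

Lemma is_derive_ge0_le f (df : R -> R) (a b : R) : a <= b ->
  (forall x, a <= x <= b -> is_derive x 1 f (df x)) ->
  (forall x, a <= x <= b -> 0 <= df x) -> f a <= f b.
Proof.
rewrite le_eqVlt => /predU1P[->//|ab] fd df0.
have [||c cab] := @MVT R f df a b ab.
- by move=> x; rewrite in_itv/= => /andP[ax xb]; apply: fd; rewrite !ltW.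
- apply: derivable_within_continuous => x; rewrite in_itv/= => xab.
  by have [] := fd x xab.
- move: cab; rewrite in_itv/= => /andP[ac cb] E.
  by rewrite -subr_ge0 E mulr_ge0 ?df0 ?(ltW ac) ?(ltW cb)// subr_ge0 ltW.
Qed.

Lemma sinh_ge (v : R) : 0 <= v -> 2 * v <= expR v - expR (- v).
Proof.
move=> v0; suff : expR 0 - expR (- 0) - 2 * 0 <= expR v - expR (- v) - 2 * v :> R.
  by rewrite oppr0 subrr mulr0 => ?; lra.
apply: (@is_derive_ge0_le (fun v => expR v - expR (- v) - 2 * v)
   (fun v => expR v + expR (- v) - 2)) => // x _; last first.
  rewrite expRN; have := expR_gt0 x; set t := expR x => t0.
  rewrite (_ : _ - _ = (t - 1) ^+ 2 / t); last by field; lra.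
  by rewrite divr_ge0 ?sqr_ge0// ltW.
apply: trigger_derive.
by rewrite /GRing.scale/=; ring.
Qed.

(** Its powers compare chi densities at points symmetric about the mode. *)
Lemma expR_ratio_le (s : R) : 0 <= s ->
  (1 - s) * expR s <= (1 + s) * expR (- s).
Proof.
move=> s0; suff : (1 + 0) * expR (- 0) - (1 - 0) * expR 0
    <= (1 + s) * expR (- s) - (1 - s) * expR s :> R.
  by rewrite oppr0 addr0 subrr subr_ge0.
apply: (@is_derive_ge0_le (fun s => (1 + s) * expR (- s) - (1 - s) * expR s)
   (fun s => s * (expR s - expR (- s)))) => // x /andP[x0 _]; last first.
  by rewrite mulr_ge0// subr_ge0 ler_expR; lra.
apply: trigger_derive.
by rewrite /GRing.scale/=; ring.
Qed.

End Derivatives.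

(** * The chi density and bounds on the chi-squared median *)

Section Medians.
Variable R : realType.
Implicit Types (x y z : R) (k : nat).

Let c1 : bounded_weight (cst 1 : R -> R).
Proof. by split => //; exists 1 => z /=; rewrite ler01 lexx. Qed.

Let vol k : R := normal_peak 1 ^+ k * ball_mass (cst 1) k 1.

Let vol_ge0 k : 0 <= vol k.
Proof. by rewrite mulr_ge0 ?exprn_ge0 ?normal_peak_ge0// ball_mass_ge0. Qed.

(** On the shell between radii [y] and [z] the Gaussian density lies between its values on the two
    bounding spheres. *)
Let chi2c_sqr_sandwich k y z : 0 < y -> y <= z ->
  expR (- z ^+ 2 / 2) * (vol k * z ^+ k - vol k * y ^+ k)
  <= chi2c k (z ^+ 2) - chi2c k (y ^+ 2)
  <= expR (- y ^+ 2 / 2) * (vol k * z ^+ k - vol k * y ^+ k).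
Proof.
move=> y0 yz; have z0 : 0 < z by lra.
have sq x : 0 < x ->
    ball_mass (cst 1) k (x ^+ 2) = x ^+ k * ball_mass (cst 1) k 1.
  move=> x0; have := ball_mass_scale k (x ^+ 2) c1 x0 ler01.
  rewrite mul1r divff ?sqrf_eq0 ?gt_eqF// => <-.
  by congr ball_mass; apply/funext => u /=; rewrite mulr1.
have hphi (u : R) : phi u = normal_peak 1 * expR (- (1 / 2) * u ^+ 2) * cst 1 u.
  by rewrite phiE mulr1; congr (_ * expR _); field.
have half : 0 <= 1 / 2 :> R by lra.
have yz2 : y ^+ 2 <= z ^+ 2 by rewrite ler_sqr ?nnegrE; lra.
have := ball_mass_compare k c1 (bounded_weight_phi R) (normal_peak_ge0 1)
  half hphi yz2.
rewrite -!chi2cE !sq// => /andP[lo up].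
apply/andP; split.
- apply: le_trans lo; rewrite (_ : - (1 / 2) * z ^+ 2 = - z ^+ 2 / 2).
    by rewrite le_eqVlt; apply/orP; left; apply/eqP; rewrite /vol; ring.
  by field.
- apply: (le_trans up); rewrite (_ : - (1 / 2) * y ^+ 2 = - y ^+ 2 / 2).
    by rewrite le_eqVlt; apply/orP; left; apply/eqP; rewrite /vol; ring.
  by field.
Qed.

(** Density of the norm of a standard Gaussian vector in dimension [k]. *)
Let density k y : R := vol k * k%:R * y ^+ k.-1 * expR (- y ^+ 2 / 2).

Let is_derive_chi2c_sqr k y : 0 < y ->
  is_derive y 1 (fun y => chi2c k (y ^+ 2)) (density k y).
Proof.
move=> y0.
have df : is_derive y 1 (fun y : R => vol k * y ^+ k) (vol k * (k%:R * y ^+ k.-1)).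
  have -> : (fun y : R => vol k * y ^+ k) = vol k \*: (id ^+ k).
    by apply/funext => u; rewrite /= exprfctE.
  apply: is_derive_eq.
  by rewrite /GRing.scale/= mulr1.
have cg : {for y, continuous (fun y : R => expR (- y ^+ 2 / 2))}.
  apply: differentiable_continuous; apply/derivable1_diffP.
  by apply: ex_derive.
have -> : density k y = expR (- y ^+ 2 / 2) * (vol k * (k%:R * y ^+ k.-1)).
  by rewrite /density; ring.
apply: (is_derive_sandwich y0 _ cg df) => z.
rewrite ltr_norml => /andP[z0 _].
have {}z0 : 0 < z by lra.
have below (p q D F : R) :
    q * F <= D <= p * F -> `|D - p * F| <= `|q - p| * `|F|.
  by move=> /andP[qD Dp]; rewrite -normrM mulrBl !ler0_norm; lra.
have above (p q D F : R) :
    p * F <= D <= q * F -> `|- D - p * - F| <= `|q - p| * `|- F|.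
  by move=> /andP[pD Dq]; rewrite -normrM mulrBl !mulrN !ler0_norm; lra.
have [yz|/ltW yz] := leP y z; first exact/below/chi2c_sqr_sandwich.
by have := above _ _ _ _ (chi2c_sqr_sandwich k z0 yz); rewrite !opprB.
Qed.

(** The chi density has mode [m], the root of [k], and is larger at [m + v] than at [m - v]. Hence
    [H (m + u) + H (m - u)] grows from [2 * H m] at [u = 0] to at most 1 as [u] approaches [m]. *)
Lemma chi2c_median_le k : (0 < k)%N -> 2 * chi2c k.+1 k%:R <= 1 :> R.
Proof.
move=> k0; pose H (y : R) := chi2c k.+1 (y ^+ 2).
have kR : 0 < k%:R :> R by rewrite ltr0n.
pose m : R := Num.sqrt k%:R.
have m0 : 0 < m by rewrite sqrtr_gt0.
have m2 : m ^+ 2 = k%:R by rewrite sqr_sqrtr// ltW.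
have mono u : 0 <= u -> u < m -> H (m + 0) + H (m - 0) <= H (m + u) + H (m - u).
  move=> u0 um; apply: (@is_derive_ge0_le _ (fun u => H (m + u) + H (m - u))
     (fun u => density k.+1 (m + u) - density k.+1 (m - u))) => //
     v /andP[v0 vu].
    have d1 : is_derive v 1 (H \o (fun u => m + u)) (density k.+1 (m + v) * 1).
      apply: is_derive1_comp; first by apply: is_derive_chi2c_sqr; lra.
      by apply: trigger_derive; ring.
    have d2 : is_derive v 1 (H \o (fun u => m - u)) (density k.+1 (m - v) * -1).
      apply: is_derive1_comp; first by apply: is_derive_chi2c_sqr; lra.
      by apply: trigger_derive; ring.
    by apply: (is_derive_eq (is_deriveD d1 d2)); rewrite mulr1 mulrN1.
  rewrite subr_ge0 /density -![_ * _ ^+ k.+1.-1 * _]mulrA ler_wpM2l//.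
    by rewrite mulr_ge0 ?vol_ge0.
  have s0 : 0 <= v / m by rewrite divr_ge0// ltW.
  have sm : 0 <= 1 - v / m by rewrite subr_ge0 ler_pdivrMr// mul1r; lra.
  have := lerXn2r k _ _ (expR_ratio_le s0).
  rewrite !nnegrE => /(_ (mulr_ge0 sm (expR_ge0 _))).
  have sp : 0 <= 1 + v / m by lra.
  move=> /(_ (mulr_ge0 sp (expR_ge0 _))).
  rewrite !exprMn -!expRM_natl -m2.
  have -> : m ^+ 2 * (v / m) = m * v by field; rewrite gt_eqF.
  have -> : m ^+ 2 * - (v / m) = - (m * v) by field; rewrite gt_eqF.
  have mk : 0 <= m ^+ k * expR (- (m ^+ 2 + v ^+ 2) / 2).
    by rewrite mulr_ge0 ?expR_ge0// exprn_ge0// ltW.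
  move=> /(ler_wpM2l mk).
  have -> : - (m - v) ^+ 2 / 2 = - (m ^+ 2 + v ^+ 2) / 2 + m * v by field.
  have -> : - (m + v) ^+ 2 / 2 = - (m ^+ 2 + v ^+ 2) / 2 + - (m * v) by field.
  rewrite !expRD.
  have -> : m - v = m * (1 - v / m) by field; rewrite gt_eqF.
  have -> : m + v = m * (1 + v / m) by field; rewrite gt_eqF.
  by rewrite !exprMn; congr (_ <= _); ring.
rewrite leNgt; apply/negP => lt.
(* The derivative is known only at positive radii, so [u] stops at [m - d], where [H d] is smaller
   than the supposed excess. *)
have [e e0 he] := @chi2c_small R k (2 * chi2c k.+1 k%:R - 1) ltac:(lra).
pose d := Num.min (Num.sqrt e) m.
have d0 : 0 < d by rewrite lt_min sqrtr_gt0 e0.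
have dm : d <= m by rewrite ge_min lexx orbT.
have de : d ^+ 2 <= e.
  rewrite -[leRHS]sqr_sqrtr ?(ltW e0)// ler_sqr ?nnegrE ?sqrtr_ge0 ?(ltW d0)//.
  by rewrite ge_min lexx.
have := @mono (m - d); rewrite subKr addr0 subr0 /H m2.
have := chi2c_le1 k.+1 ((m + (m - d)) ^+ 2).
have := chi2c_homo k.+1 de.
lra.
Qed.

(** On the logarithmic scale [a * expR v] the density peaks at [v = 0] and is larger at [- v] than
    at [v]. Hence the sum of [H] at the two points decreases from [2 * H a] towards 1. *)
Lemma chi2c_median_ge k : 1 <= 2 * chi2c k.+1 k.+1%:R :> R.
Proof.
pose H (y : R) := chi2c k.+1 (y ^+ 2).
have kR : 1 <= k.+1%:R :> R by rewrite ler1n.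
pose a : R := Num.sqrt k.+1%:R.
have a0 : 0 < a by rewrite sqrtr_gt0; lra.
have a2 : a ^+ 2 = k.+1%:R by rewrite sqr_sqrtr//; lra.
have mono v : 0 <= v ->
    H (a * expR v) + H (a * expR (- v)) <= H (a * expR 0) + H (a * expR (- 0)).
  move=> v0; rewrite -lerN2.
  apply: (@is_derive_ge0_le _ (fun v => - (H (a * expR v) + H (a * expR (- v))))
     (fun v => density k.+1 (a * expR (- v)) * (a * expR (- v))
               - density k.+1 (a * expR v) * (a * expR v))) => // u /andP[u0 _].
    have pos w : 0 < a * expR w by rewrite mulr_gt0 ?expR_gt0.
    have e1 : is_derive u 1 (fun u : R => a * expR u) (a * expR u).
      exact: (is_deriveZ a (is_derive_expR u)).
    have e2 : is_derive u 1 (fun u : R => a * expR (- u)) (a * (expR (- u) * -1)).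
      exact: (is_deriveZ a (is_derive1_comp (is_derive_expR (- u)) (is_deriveNid u 1))).
    have d1 := @is_derive1_comp _ H (fun u => a * expR u) u _ _
      (is_derive_chi2c_sqr k.+1 (pos u)) e1.
    have d2 := @is_derive1_comp _ H (fun u => a * expR (- u)) u _ _
      (is_derive_chi2c_sqr k.+1 (pos (- u))) e2.
    have d12 := is_deriveN (is_deriveD d1 d2).
    by apply: (is_derive_eq d12); rewrite mulrN1 !mulrN opprD opprK addrC.
  have dE y : density k.+1 y * y =
      vol k.+1 * k.+1%:R * (y ^+ k.+1 * expR (- y ^+ 2 / 2)).
    by rewrite /density [y ^+ k.+1]exprS /=; ring.
  rewrite subr_ge0 !dE ler_wpM2l//; first by rewrite mulr_ge0 ?vol_ge0.
  rewrite !exprMn -!expRM_natl a2 -!mulrA ler_wpM2l ?exprn_ge0 ?(ltW a0)//.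
  rewrite -!expRD ler_expR.
  have k0 : 0 <= k.+1%:R :> R by lra.
  have /sinh_ge/(ler_wpM2l k0) : 0 <= 2 * u by lra.
  by rewrite (_ : 2 * - u = - (2 * u)) ?mulrN//; lra.
(* Replaces the limit of large [v]: [v = |y|] already makes the squared outer radius exceed [y]. *)
have lower p : p < 1 -> p <= 2 * chi2c k.+1 k.+1%:R :> R.
  move=> /(chi2c_approx1 k.+1)[y py].
  have := mono `|y| (normr_ge0 y).
  rewrite oppr0 expR0 mulr1 /H a2 => h.
  have := chi2c_ge0 k.+1 ((a * expR (- `|y|)) ^+ 2).
  have : chi2c k.+1 y <= chi2c k.+1 ((a * expR `|y|) ^+ 2).
    apply: chi2c_homo; rewrite exprMn a2 -expRM_natl.
    have := expR_ge1Dx (2 * `|y|); have := ler_norm y; have := normr_ge0 y; nra.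
  lra.
rewrite leNgt; apply/negP => lt.
have := lower ((1 + 2 * chi2c k.+1 k.+1%:R) / 2); lra.
Qed.

End Medians.

(** * Neyman-Pearson comparison of balls, and Chernoff bounds at the optimal tilt *)

Section Comparison.
Variable R : realType.
Implicit Types (s t m n c r x : R) (k : nat).

Let bounded_gauss0 s : 0 < s -> bounded_weight (fun z => s^-1 * phi (z / s)).
Proof.
move=> /(@bounded_weight_gauss _ s 0).
by under [X in bounded_weight X -> _]eq_fun do rewrite subr0.
Qed.

(** The right side is the mass under N(m e, s^2 I) of the ball of squared radius [r] around c e, so
    different laws can be compared on one ball. *)
Let chi2_shift_gauss k s m c r : 0 < s ->
  chi2_shift k ((m - c) / s) (r / s ^+ 2) =
  rintegral (fun u => s^-1 * phi ((u - m) / s) *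
    ball_mass (fun z => s^-1 * phi (z / s)) k (r - (u - c) ^+ 2)).
Proof.
move=> s0; have s1 : s != 0 by rewrite gt_eqF.
have bphi := bounded_weight_phi R.
have [mg _] := bounded_weight_gauss m s0.
rewrite [RHS](@rintegral_affine _ _ s m)//; last 2 first.
- apply: measurable_funM => //.
  by apply: measurable_ball_mass; exact: bounded_gauss0.
- move=> u; rewrite mulr_ge0//; last by rewrite ball_mass_ge0//; exact: bounded_gauss0.
  by rewrite mulr_ge0 ?phi_ge0// invr_ge0 ltW.
have sV : 0 <= s^-1 by rewrite invr_ge0 ltW.
have -> : (fun u => s^-1 * phi ((s * u + m - m) / s) *
    ball_mass (fun z => s^-1 * phi (z / s)) k (r - (s * u + m - c) ^+ 2)) =
  (fun u => s^-1 * (phi u * chi2c k (r / s ^+ 2 - (u + (m - c) / s) ^+ 2))).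
  apply/funext => u; rewrite ball_mass_scale// mulVf// expr1n mul1r.
  rewrite addrK [s * u]mulrC mulfK// chi2cE -mulrA.
  by congr (_ * (_ * ball_mass _ _ _)); field.
by rewrite rintegralZ ?mulVKf//; exact: rintegrable_chi2_shift.
Qed.

(* Neyman-Pearson: when [m / s ^+ 2 = n / t ^+ 2], the likelihood ratio of
   N(m e, s^2 I) to N(n e, t^2 I) at [y] is a decreasing function of [|y|], so
   among all sets of given mass for the second law centred balls have the
   largest mass for the first. Here the competitor is the ball of squared radius
   [r] around [m e]. *)
Lemma centred_ball_optimal k s t m n x r :
  0 < s -> s <= t -> m / s ^+ 2 = n / t ^+ 2 ->
  exists2 K, 0 < K &
    K * (chi2_shift k (n / t) (x / t ^+ 2)
         - chi2_shift k ((n - m) / t) (r / t ^+ 2))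
    <= chi2_shift k (m / s) (x / s ^+ 2) - chi2c k.+1 (r / s ^+ 2).
Proof.
move=> s0 st mn; have t0 : 0 < t by lra.
have s1 : s != 0 by rewrite gt_eqF.
have t1 : t != 0 by rewrite gt_eqF.
pose kappa := (s ^- 2 - t ^- 2) / 2.
have kappa0 : 0 <= kappa.
  rewrite divr_ge0// subr_ge0 lef_pV2 ?posrE ?exprn_gt0//.
  by rewrite ler_sqr ?nnegrE; lra.
pose rho := t / s; have rho0 : 0 < rho by rewrite divr_gt0.
pose w s (z : R) := s^-1 * phi (z / s).
have bs : bounded_weight (w s) by exact: bounded_gauss0.
have bt : bounded_weight (w t) by exact: bounded_gauss0.
pose v s m (u : R) := s^-1 * phi ((u - m) / s).
have bvs : bounded_weight (v s m) by exact: bounded_weight_gauss.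
have bvt : bounded_weight (v t n) by exact: bounded_weight_gauss.
have ws z : w s z = rho * expR (- kappa * z ^+ 2) * w t z.
  rewrite /w !phiE.
  have -> : - (z / s) ^+ 2 / 2 = - kappa * z ^+ 2 + - (z / t) ^+ 2 / 2.
    by rewrite /kappa; field; rewrite s1 t1.
  by rewrite expRD /rho; field; rewrite s1 t1.
(* In the ratio of the first-coordinate densities the term linear in [u] cancels by [mn]; this
   constant remains. *)
pose rho' := rho * expR (n ^+ 2 / t ^+ 2 / 2 - m ^+ 2 / s ^+ 2 / 2).
have rho'0 : 0 < rho' by rewrite mulr_gt0 ?expR_gt0.
have vs u : v s m u = rho' * expR (- kappa * u ^+ 2) * v t n u.
  rewrite /v !phiE.
  have -> : - ((u - m) / s) ^+ 2 / 2 =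
      (n ^+ 2 / t ^+ 2 / 2 - m ^+ 2 / s ^+ 2 / 2) + - kappa * u ^+ 2
      + - ((u - n) / t) ^+ 2 / 2 + u * (m / s ^+ 2 - n / t ^+ 2).
    by rewrite /kappa; field; rewrite s1 t1.
  rewrite mn subrr mulr0 addr0 !expRD /rho' /rho expRD; field.
  by rewrite s1 t1.
(* The likelihood ratio on the boundary sphere of the centred ball. *)
pose K := rho' * (rho ^+ k * expR (- kappa * x)).
have K0 : 0 < K.
  by apply: mulr_gt0 => //; apply: mulr_gt0; [exact: exprn_gt0|exact: expR_gt0].
exists K => //.
have center : chi2c k.+1 (r / s ^+ 2) = chi2_shift k ((m - m) / s) (r / s ^+ 2).
  by rewrite subrr mul0r chi2cS.
rewrite center -[n in n / t]subr0 -[m in m / s]subr0 !chi2_shift_gauss//.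
have Is a y : rintegrable (fun u => v s m u * ball_mass (w s) k (y - (u - a) ^+ 2)).
  exact: rintegrable_ball_mass_center.
have It a y : rintegrable (fun u => v t n u * ball_mass (w t) k (y - (u - a) ^+ 2)).
  exact: rintegrable_ball_mass_center.
rewrite -/(w s) -/(w t) -!rintegralB//; try exact: Is; try exact: It.
rewrite -rintegralZ; last by apply: rintegrableB; exact: It.
apply: rintegral_le => [||u].
- by apply/rintegrableZ/rintegrableB; exact: It.
- by apply: rintegrableB; exact: Is.
rewrite -!mulrBr subr0 -/(v s m u) -/(v t n u) vs.
set d := r - (u - m) ^+ 2.
have vt0 : 0 <= v t n u by exact: bounded_weight_ge0.
have C0 : 0 <= rho' * expR (- kappa * u ^+ 2) * v t n u.
  by rewrite -vs; exact: bounded_weight_ge0.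
have kE : expR (- kappa * x) =
    expR (- kappa * u ^+ 2) * expR (- kappa * (x - u ^+ 2)).
  by rewrite -expRD; congr expR; ring.
have key : rho ^+ k * expR (- kappa * (x - u ^+ 2)) *
    (ball_mass (w t) k (x - u ^+ 2) - ball_mass (w t) k d) <=
    ball_mass (w s) k (x - u ^+ 2) - ball_mass (w s) k d.
  have [h|/ltW h] := leP d (x - u ^+ 2).
    by have /andP[] := ball_mass_compare k bt bs (ltW rho0) kappa0 ws h.
  have /andP[_] := ball_mass_compare k bt bs (ltW rho0) kappa0 ws h.
  by rewrite -lerN2 -mulrN !opprB.
apply: le_trans (ler_wpM2l C0 key).
by rewrite /K kE le_eqVlt; apply/orP; left; apply/eqP; ring.
Qed.

(** The tilt c = t^(-1/2) is optimal at k t and turns the Chernoff bound into exp(k (ln t + 1 - t) /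
    2). *)
Let tilted_lt k (p t : R) : (0 < k)%N -> 0 < t -> 0 < p ->
  ln t + 1 - t < 2 * ln p / k%:R ->
  expR ((expR (- ln t / 2) ^+ 2 - 1) * (k%:R * t) / 2) * expR (- ln t / 2) ^- k
  < p.
Proof.
move=> k0 t0 p0; have kR : 0 < k%:R :> R by rewrite ltr0n.
rewrite ltr_pdivlMr// => h.
rewrite -!expRM_natl -expRN -expRD -[ltRHS]lnK ?posrE// ltr_expR.
have -> : 2%:R * (- ln t / 2) = - ln t :> R by field.
rewrite expRN lnK ?posrE//.
rewrite [ltLHS](_ : _ = (ln t + 1 - t) * k%:R / 2); last by field; rewrite gt_eqF.
by lra.
Qed.

Lemma chi2c_lt k (p t : R) : (0 < k)%N -> 0 < t <= 1 -> 0 < p ->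
  ln t + 1 - t < 2 * ln p / k%:R -> chi2c k (k%:R * t) < p.
Proof.
move=> k0 /andP[t0 t1] p0 /(tilted_lt k0 t0 p0); apply: le_lt_trans.
apply: chi2c_chernoff; rewrite -[leLHS]expR0 ler_expR.
by have := ln_le0 t1; lra.
Qed.

Lemma chi2c_upper_lt k (p t : R) : (0 < k)%N -> 1 <= t -> 0 < p ->
  ln t + 1 - t < 2 * ln p / k%:R -> 1 - chi2c k (k%:R * t) < p.
Proof.
move=> k0 t1 p0; have t0 : 0 < t by lra.
move=> /(tilted_lt k0 t0 p0); apply: le_lt_trans.
apply: chi2c_upper_chernoff; rewrite expR_gt0/= -[leRHS]expR0 ler_expR.
by have := ln_ge0 t1; lra.
Qed.

End Comparison.

(** * The two cases of the theorem *)

Section Cases.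
Variable R : realType.
Implicit Types (pA s a : R) (k : nat).

Let sqrt_shift s a d : 0 < s -> 0 <= a -> 0 < d ->
  Num.sqrt (s ^+ 2 * a ^+ 2 / d ^+ 2) = s * a / d :> R.
Proof.
move=> s0 a0 d0; rewrite -exprMn -expr_div_n sqrtr_sqr ger0_norm//.
by rewrite divr_ge0 ?mulr_ge0// ltW.
Qed.

Let gt_half (K P S M X : R) : 0 < K -> S < P -> K * (P - S) <= X - M ->
  1 <= 2 * M -> 1 / 2 < X.
Proof.
move=> K0 SP opt M1; have : 0 < K * (P - S) by rewrite mulr_gt0// subr_gt0.
lra.
Qed.

Let lt_half (K P C S M X : R) : 0 < K -> 1 - C < 1 - P ->
  K * (X - S) <= P - C -> S <= M -> 2 * M <= 1 -> X < 1 / 2.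
Proof.
move=> K0 PC opt SM M1; have : K * (X - S) < 0 by lra.
by rewrite pmulr_rlt0//; lra.
Qed.

Lemma xi_gt_lower k pA (s0 s1 : R) a : 0 < pA < 1 -> 0 < s1 < s0 -> 0 <= a ->
  ln (s1 ^+ 2 / s0 ^+ 2) + 1 - s1 ^+ 2 / s0 ^+ 2 < 2 * ln (1 - pA) / k.+2%:R ->
  1 / 2 < xi_gt k.+2 s0 pA a s1.
Proof.
move=> /andP[p0 p1] /andP[s1_gt0 s10] a0 hyp.
have s0_gt0 : 0 < s0 by lra.
have d0 : 0 < s0 ^+ 2 - s1 ^+ 2 by rewrite subr_gt0 ltr_sqr ?nnegrE; lra.
have p01 : 0 < 1 - pA < 1 by apply/andP; split; lra.
rewrite /xi_gt; set q := chi2_qf _ _ _.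
have := chi2_qfK k (s0 ^+ 2 * a ^+ 2 / (s0 ^+ 2 - s1 ^+ 2) ^+ 2) p01.
have t01 : 0 < s1 ^+ 2 / s0 ^+ 2 <= 1.
  rewrite divr_gt0 ?exprn_gt0//= ler_pdivrMr ?exprn_gt0// mul1r.
  by rewrite !expr2; apply: ler_pM; exact: ltW.
rewrite -/q !chi2E !sqrt_shift//; set d := s0 ^+ 2 - s1 ^+ 2 in d0 *.
have [s0n s1n dn] : [/\ s0 != 0, s1 != 0 & d != 0] by rewrite !gt_eqF.
(* Positions of the means of Y_1 and Y_0 on an axis whose origin is the centre of the optimal ball;
   they differ by [a]. *)
pose m := s1 ^+ 2 * a / d; pose n := s0 ^+ 2 * a / d.
have mn : m / s1 ^+ 2 = n / s0 ^+ 2 by rewrite /m /n; field; rewrite s0n s1n dn.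
have [K K0] := @centred_ball_optimal _ k.+1 s1 s0 m n (s0 ^+ 2 * q)
  (s1 ^+ 2 * k.+2%:R) s1_gt0 (ltW s10) mn.
have -> : n / s0 = s0 * a / d by rewrite /n; field; rewrite s0n dn.
have -> : m / s1 = s1 * a / d by rewrite /m; field; rewrite s1n dn.
have -> : s0 ^+ 2 * q / s0 ^+ 2 = q by field.
have -> : s0 ^+ 2 * q / s1 ^+ 2 = s0 ^+ 2 / s1 ^+ 2 * q by field.
have -> : s1 ^+ 2 * k.+2%:R / s1 ^+ 2 = k.+2%:R by field.
have -> : s1 ^+ 2 * k.+2%:R / s0 ^+ 2 = k.+2%:R * (s1 ^+ 2 / s0 ^+ 2) by field.
move=> opt qE; rewrite qE in opt.
apply: gt_half K0 _ opt (@chi2c_median_ge R k.+1).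
apply: le_lt_trans (chi2_shift_le _ _ _) _.
exact: chi2c_lt (proj1 (andP p01)) hyp.
Qed.

(** From ln t >= 1 - 1/t, the left side of the hypothesis is at least -(1 - t)^2 / t >= -1 / (n (n -
    1)); hence ln(1 - pA) > -1/2 and 1 - pA > exp(-1/2) >= 1/2. *)
Let pA_lt_half (n : R) pA t : 2 <= n -> pA < 1 -> (n - 1) / n < t < 1 ->
  ln t + 1 - t < 2 * ln (1 - pA) / n -> pA < 1 / 2.
Proof.
move=> n2 p1 /andP[tn t1] hyp.
have n0 : 0 < n by lra.
have t0 : 0 < t by apply: lt_trans tn; rewrite divr_gt0//; lra.
have lnt : 1 - t^-1 <= ln t.
  have := expR_ge1Dx (- ln t); rewrite expRN lnK ?posrE//; lra.
have bound : - (n^-1 / (n - 1)) <= ln t + 1 - t.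
  have : (1 - t) ^+ 2 / t <= n^-1 / (n - 1).
    have h1 : 1 - t <= n^-1.
      by move: tn; rewrite mulrBl divff ?gt_eqF// mul1r; lra.
    have -> : n^-1 / (n - 1) = n^-1 ^+ 2 / ((n - 1) / n) by field; lra.
    apply: ler_pM; rewrite ?sqr_ge0 ?invr_ge0 ?(ltW t0)//.
      by rewrite ler_sqr ?nnegrE ?invr_ge0; lra.
    by rewrite lef_pV2 ?posrE ?(ltW tn)// divr_gt0//; lra.
  rewrite (_ : (1 - t) ^+ 2 / t = t^-1 + t - 2); last by field; lra.
  lra.
have : - (1 / 2) < ln (1 - pA).
  have : - (n^-1 / (n - 1)) < 2 * ln (1 - pA) / n by lra.
  rewrite ltr_pdivlMr//.
  rewrite (_ : - (n^-1 / (n - 1)) * n = - (n - 1)^-1); last by field; lra.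
  have : (n - 1)^-1 <= 1 by rewrite invf_le1; lra.
  lra.
move=> h; have : expR (- (1 / 2)) < 1 - pA.
  by rewrite -[ltRHS]lnK ?posrE ?ltr_expR//; lra.
have := expR_ge1Dx (- (1 / 2) : R); lra.
Qed.

Lemma xi_lt_lower k pA (s0 s1 : R) a : 0 < pA < 1 -> 0 < s0 < s1 -> 0 <= a ->
  ln (s1 ^+ 2 / s0 ^+ 2 * ((k.+2%:R - 1) / k.+2%:R)) + 1
    - s1 ^+ 2 / s0 ^+ 2 * ((k.+2%:R - 1) / k.+2%:R)
    < 2 * ln (1 - pA) / k.+2%:R ->
  1 / 2 < xi_lt k.+2 s0 pA a s1.
Proof.
move=> p01 /andP[s0_gt0 s01] a0 hyp.
have half (x : R) : x < 1 / 2 -> 1 / 2 < 1 - x by lra.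
have [p0 p1] := andP p01.
have s1_gt0 : 0 < s1 by lra.
have d0 : 0 < s1 ^+ 2 - s0 ^+ 2 by rewrite subr_gt0 ltr_sqr ?nnegrE; lra.
rewrite /xi_lt; set q := chi2_qf _ _ _.
have := chi2_qfK k (s0 ^+ 2 * a ^+ 2 / (s1 ^+ 2 - s0 ^+ 2) ^+ 2) p01.
rewrite -/q !chi2E !sqrt_shift//; set d := s1 ^+ 2 - s0 ^+ 2 in d0 *.
have [s0n s1n dn] : [/\ s0 != 0, s1 != 0 & d != 0] by rewrite !gt_eqF.
pose m := s0 ^+ 2 * a / d; pose n := s1 ^+ 2 * a / d.
have mn : m / s0 ^+ 2 = n / s1 ^+ 2 by rewrite /m /n; field; rewrite s0n s1n dn.
have nE : n / s1 = s1 * a / d by rewrite /n; field; rewrite s1n dn.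
have mE : m / s0 = s0 * a / d by rewrite /m; field; rewrite s0n dn.
move=> qE; set X := chi2_shift _ _ _.
(* The competitor is the ball of squared radius [s0 ^+ 2 * y] around the mean of Y_0; [y] is left
   free for the two cases on [t]. *)
have opt y : exists2 K, 0 < K &
    K * (X - chi2_shift k.+1 ((n - m) / s1) (s0 ^+ 2 * y / s1 ^+ 2))
    <= pA - chi2c k.+2 y.
  have [K K0] := @centred_ball_optimal _ k.+1 s0 s1 m n (s0 ^+ 2 * q)
    (s0 ^+ 2 * y) s0_gt0 (ltW s01) mn.
  rewrite nE mE.
  have -> : s0 ^+ 2 * q / s0 ^+ 2 = q by field.
  have -> : s0 ^+ 2 * y / s0 ^+ 2 = y by field.
  have -> : s0 ^+ 2 * q / s1 ^+ 2 = s0 ^+ 2 / s1 ^+ 2 * q by field.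
  by rewrite qE; exists K.
apply: half.
have t1 : 1 < s1 ^+ 2 / s0 ^+ 2.
  by rewrite ltr_pdivlMr ?exprn_gt0// mul1r ltr_sqr ?nnegrE; lra.
have k2 : 2 <= k.+2%:R :> R by rewrite ler_nat.
set t := s1 ^+ 2 / s0 ^+ 2 * _ in hyp; have [t_ge1|t_lt1] := leP 1 t.
(* With N = [k.+2], this [y] makes the squared radius (N - 1) s1^2, the median bound in units of
   [s1]. *)
- have [K K0] := opt (k.+2%:R * t).
  have -> : s0 ^+ 2 * (k.+2%:R * t) / s1 ^+ 2 = k.+1%:R.
    by rewrite /t -!natr1; field; rewrite s0n s1n /= natr1 natr1 pnatr_eq0.
  move=> /(lt_half K0); apply.
  - by apply: chi2c_upper_lt => //; rewrite subr_gt0.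
  - exact: chi2_shift_le.
  - exact: chi2c_median_le.
- have pA2 : pA < 1 / 2.
    apply: (@pA_lt_half k.+2%:R pA t) => //; rewrite t_lt1 andbT.
    by rewrite /t ltr_pMl// divr_gt0//; lra.
  pose q' := chi2_qf k.+2 0 pA.
  have qE' : chi2c k.+2 q' = pA.
    by have := chi2_qfK k 0 p01; rewrite chi2E sqrtr0 -chi2cS.
  have q'0 : 0 <= q'.
    rewrite leNgt; apply/negP => /(chi2c_lt0 k.+2); rewrite qE'; lra.
  (* This competitor has mass exactly [pA] for Y_0, and at most [pA] for Y_1, which is more spread
     out. *)
  have [K K0] := opt q'; rewrite qE' subrr pmulr_rle0// subr_le0 => XS.
  apply: le_lt_trans XS _.
  apply: le_lt_trans (chi2_shift_le _ _ _) _.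
  apply: le_lt_trans pA2; rewrite -[leRHS]qE'; apply: chi2c_homo.
  rewrite mulrAC ler_piMl// ler_pdivrMr ?exprn_gt0// mul1r.
  by rewrite ler_sqr ?nnegrE; lra.
Qed.

End Cases.

Theorem mainTheorem4 (R : realType) (N : nat) (pA s0 s1 : R) :
  (2 <= N)%N -> 0 < pA < 1 -> 0 < s0 -> 0 < s1 ->
  (s1 < s0 ->
     ln (s1 ^+ 2 / s0 ^+ 2) + 1 - s1 ^+ 2 / s0 ^+ 2 < 2 * ln (1 - pA) / N%:R ->
     forall a : R, 0 <= a -> 1 / 2 < xi_gt N s0 pA a s1) /\
  (s0 < s1 ->
     ln (s1 ^+ 2 / s0 ^+ 2 * ((N%:R - 1) / N%:R)) + 1
       - s1 ^+ 2 / s0 ^+ 2 * ((N%:R - 1) / N%:R) < 2 * ln (1 - pA) / N%:R ->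
     forall a : R, 0 <= a -> 1 / 2 < xi_lt N s0 pA a s1).
Proof.
case: N => [|[|k]]// _ p01 s0_gt0 s1_gt0; split=> s01 hyp a a0.
- by apply: xi_gt_lower => //; rewrite s1_gt0.
- by apply: xi_lt_lower => //; rewrite s0_gt0.
Qed.
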